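(* Let $\Delta\ge 3$ be an integer and let $p=R(K_\Delta)$. Then the family $\mathcal{G}_\Delta$ of all graphs with maximum degree at most $\Delta$ is Folkman $p$-linear; that is, there exists a constant $c=c(\Delta)>0$ such that $f(G_n;p)\le cn$ for every $n$ and every graph $G_n$ of order $n$ with $\Delta(G_n)\le\Delta$.
   Context: Graphs are finite and simple. For graphs $F$ and $G$, $F\to(G,G)$ means that any red/blue edge coloring of $F$ contains a monochromatic copy of $G$ (as a not necessarily induced subgraph). The Ramsey number $R(G)$ is the smallest $N$ such that $K_N\to(G,G)$; $K_\Delta$ is the complete graph on $\Delta$ vertices. $\omega(F)$ is the clique number of $F$ and $\Delta(G)$ is the maximum degree of $G$. The Folkman number is $$f(G;p)=\min\{|V(F)| : F\to(G,G)\text{ and }\omega(F)\le p\},$$ with $f(G;p)=\infty$ if no such $F$ exists. *)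

(* Defs.v *)
From HB Require Import structures.
From mathcomp Require Import all_boot all_order all_algebra.
From mathcomp Require Import boolp reals constructive_ereal.

Set Implicit Arguments.
Unset Strict Implicit.
Unset Printing Implicit Defensive.

Record sgraph := SGraph {
  vertex :> finType;
  edge : rel vertex;
  edge_sym : symmetric edge;
  edge_irrefl : irreflexive edge }.

Lemma complete_sym n : symmetric (fun x y : 'I_n => x != y).
Proof. by move=> x y; rewrite eq_sym. Qed.

Lemma complete_irrefl n : irreflexive (fun x y : 'I_n => x != y).
Proof. by move=> x; rewrite eqxx. Qed.

Definition complete_graph (n : nat) : sgraph :=
  SGraph (@complete_sym n) (@complete_irrefl n).

Definition max_degree (G : sgraph) : nat :=
  \max_(x : G) #|[set y : G | edge x y]|.

Definition is_clique (G : sgraph) (K : {set G}) : bool :=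
  [forall x in K, forall y in K, (x != y) ==> edge x y].

Definition clique_number (G : sgraph) : nat :=
  \max_(K : {set G} | is_clique K) #|K|.

(* A two-colouring of the edges of F is encoded as a boolean function on all
   sets of vertices; only its values on the pairs [set x; y] with [edge x y]
   are ever consulted.  The relation F -> (G, G) is [arrows F G]. *)
Definition mono_copy (F G : sgraph) (col : {set F} -> bool) (b : bool) : Prop :=
  exists2 f : G -> F, injective f &
    forall x y : G, edge x y ->
      edge (f x) (f y) /\ col [set f x; f y] = b.

Definition arrows (F G : sgraph) : Prop :=
  forall col : {set F} -> bool, exists b : bool, mono_copy G col b.

Lemma ramsey_sets (s t : nat) : exists N : nat,
  forall (T : finType) (c : rel T) (A : {set T}), symmetric c -> N <= #|A| ->
  (exists S : {set T},
     s <= #|S| /\ S \subset A /\ {in S &, forall x y, x != y -> c x y}) \/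
  (exists S : {set T},
     t <= #|S| /\ S \subset A /\ {in S &, forall x y, x != y -> ~~ c x y}).
Proof.
move: {2}(s + t) (leqnn (s + t)) => m; elim: m s t => [|m IH] s t.
  rewrite leqn0 addn_eq0 => /andP[/eqP-> _]; exists 0 => T c A _ _.
  by left; exists set0; split=> //; split=> [|x y]; rewrite ?sub0set ?inE.
case: s => [|s] st.
  exists 0 => T c A _ _.
  by left; exists set0; split=> //; split=> [|x y]; rewrite ?sub0set ?inE.
case: t st => [|t] st.
  exists 0 => T c A _ _.
  by right; exists set0; split=> //; split=> [|x y]; rewrite ?sub0set ?inE.
have [N1 H1] := IH s t.+1 ltac:(by rewrite -ltnS -addSn).
have [N2 H2] := IH s.+1 t ltac:(by rewrite -ltnS -addnS).
exists (N1 + N2).+1 => T c A csym leA.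
have /card_gt0P[x xA] : 0 < #|A| by apply: leq_trans leA.
pose B := [set y in A :\ x | c x y]; pose C := [set y in A :\ x | ~~ c x y].
have BA : B \subset A by apply/subsetP => y; rewrite !inE => /andP[/andP[]].
have CA : C \subset A by apply/subsetP => y; rewrite !inE => /andP[/andP[]].
have BC : N1 + N2 <= #|B| + #|C|.
  have -> : #|B| + #|C| = #|A :\ x|.
    rewrite -(cardsID [set y | c x y] (A :\ x)); congr (_ + _);
      by apply: eq_card => y; rewrite !inE // andbC.
  by move: leA; rewrite (cardsD1 x A) xA.
have [leB|ltB] := leqP N1 #|B|.
- have [[S [sS [SB mS]]]|[S [tS [SB mS]]]] := H1 T c B csym leB; last first.
    by right; exists S; split=> //; split=> //; apply: subset_trans BA.
  have Sx y : y \in S -> (y != x) && c x y.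
    by move/(subsetP SB); rewrite !inE => /andP[/andP[-> _] ->].
  left; exists (x |: S); split; first rewrite cardsU1.
    by have -> : x \notin S by apply/negP => /Sx; rewrite eqxx.
  split; first by rewrite subUset sub1set xA (subset_trans SB).
  move=> y z; rewrite !inE => /orP[/eqP->|yS] /orP[/eqP->|zS].
  + by rewrite eqxx.
  + by move=> _; have /andP[] := Sx z zS.
  + by move=> _; rewrite csym; have /andP[] := Sx y yS.
  + exact: mS.
have leC : N2 <= #|C|.
  by rewrite leqNgt; apply/negP => ltC; move: BC;
     rewrite leqNgt (leq_ltn_trans _ (_ : #|B| + N2 < N1 + N2)) ?ltn_add2r //
             leq_add2l ltnW.
have [[S [sS [SC mS]]]|[S [tS [SC mS]]]] := H2 T c C csym leC.
  by left; exists S; split=> //; split=> //; apply: subset_trans CA.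
have Sx y : y \in S -> (y != x) && ~~ c x y.
  by move/(subsetP SC); rewrite !inE => /andP[/andP[-> _] ->].
right; exists (x |: S); split; first rewrite cardsU1.
  by have -> : x \notin S by apply/negP => /Sx; rewrite eqxx.
split; first by rewrite subUset sub1set xA (subset_trans SC).
move=> y z; rewrite !inE => /orP[/eqP->|yS] /orP[/eqP->|zS].
- by rewrite eqxx.
- by move=> _; have /andP[] := Sx z zS.
- by move=> _; rewrite csym; have /andP[] := Sx y yS.
- exact: mS.
Qed.

Lemma ramsey_exists (G : sgraph) :
  exists N : nat, `[< arrows (complete_graph N) G >].
Proof.
have [N HN] := ramsey_sets #|G| #|G|; exists N; apply/asboolP => col.
pose c : rel 'I_N := fun x y => col [set x; y].
have csym : symmetric c by move=> x y; rewrite /c setUC.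
have emb (S : {set 'I_N}) : #|G| <= #|S| ->
    exists2 f : G -> 'I_N, injective f & forall x, f x \in S.
  move=> leS; exists (fun x => enum_val (widen_ord leS (enum_rank x))).
    by move=> x y /enum_val_inj /(congr1 val) /= /val_inj /enum_rank_inj.
  by move=> x; apply: enum_valP.
have fedge (f : G -> 'I_N) x y : injective f -> edge x y -> f x != f y.
  by move=> fi; apply: contraTneq => /fi->; rewrite edge_irrefl.
have [|[S [/emb[f fi fS] [_ mS]]]|[S [/emb[f fi fS] [_ mS]]]] :=
  HN _ c [set: 'I_N] csym; first by rewrite cardsT card_ord.
- exists true; exists f => // x y xy; split; first exact: fedge xy.
  exact: mS (fedge _ _ _ fi xy).
- exists false; exists f => // x y xy; split; first exact: fedge xy.
  exact/negbTE/mS/(fedge _ _ _ fi xy).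
Qed.

Definition ramsey (G : sgraph) : nat := ex_minn (ramsey_exists G).

Definition folkman_order (G : sgraph) (p N : nat) : Prop :=
  exists F : sgraph, [/\ #|F| = N, arrows F G & clique_number F <= p].

Definition folkman (R : realType) (G : sgraph) (p : nat) : \bar R :=
  match pselect (exists N : nat, `[< folkman_order G p N >]) with
  | left exN => ((ex_minn exN)%:R)%:E
  | right _ => +oo%E
  end.

Definition folkman_linear (R : realType) (p : nat) (family : sgraph -> Prop) :
    Prop :=
  exists c : R, (0 < c)%R /\
    forall (n : nat) (G : sgraph), family G -> #|G| = n ->
      (folkman R G p <= (c * n%:R)%:E)%E.

(* Main.v *)
Require Import Defs.
From mathcomp Require Import all_boot all_order all_algebra.
From mathcomp Require Import ring lra zify.
From mathcomp Require Import boolp reals constructive_ereal.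

(* Put [k = Delta + 1].  Folkman's theorem, proved by the partite construction of
   Nesetril and Rodl on top of the Hales-Jewett theorem, gives a fixed graph H
   of clique number at most [k] with H -> (K_k, K_k).  The host graph F is the blow-up
   of H with all vertex classes of size [C * n], which has the same clique number.
   Given a two-colouring of F, a density increment argument applied to each pair of classes
   in turn yields linear-sized subsets of the classes such that, for every pair, one
   colour has density at least 1/4 between any two not too small subsets; colouring
   the edges of H accordingly, we find [k] classes that are pairwise linked in this
   sense by the same colour.  A greedy [k]-colouring of G tells which class to use for
   each vertex, and G is embedded vertex by vertex, each unembedded vertex keeping a
   candidate set of size at least [4 ^ (- Delta)] times that of its class.
   As [k <= R(K_Delta)] for [Delta >= 3], this is enough. *)

Set Implicit Arguments.
Unset Strict Implicit.
Unset Printing Implicit Defensive.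
Import Order.TTheory GRing.Theory Num.Theory.

(** * Hales-Jewett theorem *)

(* A combinatorial line is a word with wildcards [None], at least one of them. *)
Definition line_point (I E : finType) (l : {ffun I -> option E}) (e : E) :
    {ffun I -> E} :=
  [ffun i => odflt e (l i)].

Definition hales_jewett_for (E : finType) :=
  forall C : finType, exists I : finType, forall col : {ffun I -> E} -> C,
  exists2 l : {ffun I -> option E}, exists i, l i = None &
    forall e e', col (line_point l e) = col (line_point l e').

(** The letter added to [E] is [None : option E]. In a line over [option E] it is written
    [Some None], a bare [None] being a wildcard; so [line_point l None] is the point where the
    wildcards receive the new letter. *)
Lemma hales_jewett_step (E : finType) :
  hales_jewett_for E -> hales_jewett_for (option E).
Proof.
move=> HJ C.
have [/existsP[e0 _]|noE] := boolP [exists e : E, true]; last first.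
  exists unit => col; exists [ffun=> None]; first by exists tt; rewrite ffunE.
  suff all_None (e : option E) : e = None.
    by move=> e e'; rewrite (all_None e) (all_None e').
  by case: e => // e; case/existsP: noE; exists e.
(* colour focusing: lines through a common last point [f] which, without it, are
   monochromatic in the pairwise distinct colours of [S] *)
suff focus s : exists I : finType, forall col : {ffun I -> option E} -> C,
    (exists2 l : {ffun I -> option (option E)}, exists i, l i = None &
       forall e e', col (line_point l e) = col (line_point l e')) \/
    exists f : {ffun I -> option E}, exists2 S : {set C}, s <= #|S| &
      forall c, c \in S -> exists l : {ffun I -> option (option E)},
        [/\ exists i, l i = None, line_point l None = f &
            forall e : E, col (line_point l (Some e)) = c].
  (* More focused colours than there are colours is absurd, so only a monochromatic line is left. *)
  have [I HI] := focus #|C|.+1; exists I => col.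
  by have [//|[f [S leS _]]] := HI col; move: (leq_trans leS (max_card _)); rewrite ltnn.
elim: s => [|s [I IH]].
  by exists void => col; right; exists [ffun=> None]; exists set0 => // c; rewrite inE.
(* A colour is now a whole colouring of the words on [I]. Along the line [l] that colouring does not
   depend on the letter of [E], which gives [colI]. *)
have [J HJ'] := HJ {ffun {ffun I -> option E} -> C}.
pose glue T (u : {ffun J -> T}) (v : {ffun I -> T}) : {ffun J + I -> T} :=
  [ffun k => match k with inl j => u j | inr i => v i end].
exists (J + I)%type => col.
pose col' (w : {ffun J -> E}) : {ffun {ffun I -> option E} -> C} :=
  [ffun v => col (glue _ [ffun j => Some (w j)] v)].
have [l [j0 lj0] lcol] := HJ' col'.
pose lift_l : {ffun J -> option (option E)} := [ffun j => omap Some (l j)].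
have lift_Some e : line_point lift_l (Some e) = [ffun j => Some (line_point l e j)].
  by apply/ffunP => j; rewrite !ffunE; case: (l j).
pose colI v := col (glue _ (line_point lift_l (Some e0)) v).
have colIE e v : col (glue _ (line_point lift_l (Some e)) v) = colI v.
  rewrite /colI !lift_Some.
  by have /(congr1 (fun g : {ffun _} => g v)) := lcol e e0; rewrite !ffunE.
pose wc (l' : {ffun I -> option (option E)}) := glue _ lift_l l'.
have wcE l' e : line_point (wc l') e = glue _ (line_point lift_l e) (line_point l' e).
  by apply/ffunP => -[j|i]; rewrite !ffunE.
pose cst l' := glue _ [ffun j => Some (line_point lift_l (Some e0) j)] l'.
have cstE l' e : col (line_point (cst l') e) = colI (line_point l' e).
  by congr col; apply/ffunP => -[j|i]; rewrite !ffunE.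
have [[l' [i0 l'i0] l'col]|[f [S leS HS]]] := IH colI.
  left; exists (cst l'); first by exists (inr i0); rewrite ffunE.
  by move=> e e'; rewrite !cstE; apply: l'col.
(* If the focus has a colour of [S], the line carrying that colour keeps it at its last point and is
   monochromatic. *)
have [fS|fS] := boolP (colI f \in S).
  have [l' [[i0 l'i0] l'f l'col]] := HS _ fS.
  left; exists (cst l'); first by exists (inr i0); rewrite ffunE.
  suff E1 e : colI (line_point l' e) = colI f by move=> e e'; rewrite !cstE !E1.
  by case: e => [e|]; [rewrite l'col|rewrite l'f].
(* Otherwise [colI f] is a new colour, carried by the line with wildcards in [J] only and [f] on
   [I]. The old colours are carried by lines with wildcards in both blocks, and all these lines end
   at the same point. *)
right; exists (glue _ (line_point lift_l None) f).
exists (colI f |: S); first by rewrite cardsU1 fS.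
move=> c; rewrite !inE => /orP[/eqP->|/HS[l' [[i0 l'i0] l'f l'col]]]; last first.
  exists (wc l'); split; first by exists (inr i0); rewrite ffunE.
    by rewrite wcE l'f.
  by move=> e; rewrite wcE colIE.
have pc e : line_point [ffun i => Some (f i)] e = f.
  by apply/ffunP => i; rewrite !ffunE.
exists (wc [ffun i => Some (f i)]); split.
- by exists (inl j0); rewrite !ffunE lj0.
- by rewrite wcE pc.
- by move=> e; rewrite wcE colIE pc.
Qed.

(** Alphabets in the shape that [hales_jewett_step] produces; the general case follows by transport
    along a bijection. *)
Fixpoint letters n : finType := if n is m.+1 then option (letters m) else void.

Lemma card_letters n : #|letters n| = n.
Proof. by elim: n => [|n IHn]; rewrite ?card_void //= card_option IHn. Qed.

Theorem hales_jewett (E : finType) : hales_jewett_for E.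
Proof.
have : hales_jewett_for (letters #|E|).
  elim: #|E| => [|n]; last exact: hales_jewett_step.
  move=> C; exists unit => col.
  by exists [ffun=> None]; [exists tt; rewrite ffunE|case].
move=> HJ C; have [I HI] := HJ C; exists I => col.
pose g (a : letters #|E|) : E := enum_val (cast_ord (card_letters _) (enum_rank a)).
pose h (e : E) : letters #|E| := enum_val (cast_ord (esym (card_letters _)) (enum_rank e)).
have hK : cancel h g.
  by move=> e; rewrite /g /h enum_valK cast_ordKV enum_rankK.
have [l [i0 li0] lcol] := HI (fun w => col [ffun i => g (w i)]).
exists [ffun i => omap g (l i)]; first by exists i0; rewrite ffunE li0.
suff E1 e : line_point [ffun i => omap g (l i)] e = [ffun i => g (line_point l (h e) i)].
  by move=> e e'; rewrite !E1; apply: lcol.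
by apply/ffunP => i; rewrite !ffunE; case: (l i) => //=; rewrite hK.
Qed.

(** * Partite construction *)

Lemma clique_numberP (G : sgraph) k :
  reflect (forall K : {set G}, is_clique K -> #|K| <= k) (clique_number G <= k).
Proof. exact/bigmax_leqP. Qed.

Lemma is_cliqueP (G : sgraph) (K : {set G}) :
  reflect {in K &, forall x y, x != y -> edge x y} (is_clique K).
Proof.
apply: (iffP forall_inP) => [H x y xK yK xy|H x xK].
  by have /forall_inP/(_ y yK)/implyP := H x xK; apply.
by apply/forall_inP => y yK; apply/implyP; apply: H.
Qed.

(* Amalgamation along lines: the edges between the parts [i] and [j] of [P] form
   the alphabet, and every line [l] carries a copy of [P], its parts [i] and [j]
   being placed among the words; copies for distinct lines share only words. *)
Section Amalgam.
Variables (a : nat) (P : sgraph) (pi : P -> 'I_a).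
Hypothesis piP : forall x y : P, edge x y -> pi x != pi y.
Variables i j : 'I_a.
Hypothesis ij : i != j.

Definition letter : finType :=
  {e : P * P | [&& edge e.1 e.2, pi e.1 == i & pi e.2 == j]}.
Variable I : finType.
Definition template : finType := {ffun I -> option letter}.
Definition amalgam_vertex : finType := ('I_a * {ffun I -> P} * option template)%type.

Definition copy_in (l : template) (x : P) : amalgam_vertex :=
  (pi x,
   [ffun t => if l t is Some e then
                if pi x == i then (val e).1 else if pi x == j then (val e).2 else x
              else x],
   if (pi x == i) || (pi x == j) then None else Some l).

Definition amalgam_edge : rel amalgam_vertex := fun u v =>
  [exists l : template, [exists x : P, [exists y : P,
    [&& [exists t, l t == None], edge x y, u == copy_in l x & v == copy_in l y]]]].

Lemma amalgam_edgeP u v : reflect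
  (exists (l : template) (x y : P), [/\ exists t, l t = None, edge x y,
    u = copy_in l x & v = copy_in l y])
  (amalgam_edge u v).
Proof.
apply: (iffP existsP) => [[l /existsP[x /existsP[y]]]|[l [x [y [[t lt] xy -> ->]]]]].
  move=> /and4P[/existsP[t /eqP lt] xy /eqP-> /eqP->].
  by exists l, x, y; split=> //; exists t.
exists l; apply/existsP; exists x; apply/existsP; exists y.
by rewrite xy !eqxx !andbT; apply/existsP; exists t; rewrite lt.
Qed.

Lemma amalgam_sym : symmetric amalgam_edge.
Proof.
by move=> u v; apply/amalgam_edgeP/amalgam_edgeP => -[l [x [y [lt xy -> ->]]]];
  exists l, y, x; split=> //; rewrite edge_sym.
Qed.

Lemma amalgam_proj u v : amalgam_edge u v -> u.1.1 != v.1.1.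
Proof. by move=> /amalgam_edgeP[l [x [y [_ xy -> ->]]]]; apply: piP. Qed.

Lemma amalgam_irrefl : irreflexive amalgam_edge.
Proof.
by move=> u; case uu: (amalgam_edge u u) => //; have := amalgam_proj uu; rewrite eqxx.
Qed.

Definition amalgam : sgraph := SGraph amalgam_sym amalgam_irrefl.

Lemma copy_in_inj (l : template) : (exists t, l t = None) -> injective (copy_in l).
Proof.
move=> [t lt] x y [_ e _]; move/ffunP/(_ t): e.
by rewrite !ffunE lt.
Qed.

(** Copies are induced. A tagged endpoint forces [l' = l]. If both endpoints are words, reading them
    at a wildcard of [l] gives [x] and [y], which are then either the ends of a letter of [l'] or
    the vertices [x'] and [y'] themselves, hence adjacent in [P]. *)
Lemma copy_in_edge (l : template) x y : (exists t, l t = None) ->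
  amalgam_edge (copy_in l x) (copy_in l y) -> edge x y.
Proof.
move=> lt /amalgam_edgeP[l' [x' [y' [l't xy ex ey]]]].
have same : l = l' -> edge x y.
  by move=> ll; subst l'; rewrite (copy_in_inj lt ex) (copy_in_inj lt ey).
move: (ex) (ey); case: lt => t lt.
move=> [px wx qx] [py wy qy].
move: qx qy; rewrite -px -py.
case: ifP => // X; last by case=> ll _; apply: same.
case: ifP => // Y; last by move=> _ [ll]; apply: same.
move=> _ _; have xy' := piP xy; rewrite -px -py in xy'.
move/ffunP/(_ t): wx; move/ffunP/(_ t): wy; rewrite !ffunE lt -px -py => -> ->.
case: (l' t) => // e; have /and3P[ee _ _] := valP e.
case/orP: X xy' => /eqP->; case/orP: Y => /eqP->; rewrite ?eqxx // => _.
  by rewrite eq_sym (negbTE ij).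
by rewrite eq_sym (negbTE ij) edge_sym.
Qed.

(** The tag of one clique vertex places the whole clique in a single induced copy of [P]. A clique
    without tags lives in the parts [i] and [j] and has at most two vertices. *)
Lemma amalgam_clique k : 1 < k -> clique_number P <= k -> clique_number amalgam <= k.
Proof.
move=> k1 /clique_numberP Pk; apply/clique_numberP => K /is_cliqueP cK.
have [/existsP[u /andP[uK uo]]|] :=
  boolP [exists u, (u \in K) && (u.2 != None)]; last first.
  rewrite negb_exists => /forallP words.
  apply: leq_trans (_ : #|[set i; j]| <= k); last by rewrite cards2 ij.
  have fstK : {in K &, injective (fun u : amalgam => u.1.1)}.
    move=> u v uK vK e; apply: contraTeq isT => uv.
    by have := amalgam_proj (cK _ _ uK vK uv); rewrite e eqxx.
  (* An isolated vertex of the amalgam need not come from any copy, so its part is only controlled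
     once it has a neighbour. *)
  have [K1|K1] := leqP #|K| 1; first by rewrite (leq_trans K1) // cards2 ij.
  rewrite -(card_in_imset fstK); apply/subset_leq_card/subsetP => _ /imsetP[u uK ->].
  have [v vK uv] : exists2 v, v \in K & v != u.
    move: K1; rewrite (cardsD1 u) uK add1n ltnS card_gt0 => /set0Pn[v].
    by rewrite !inE => /andP[vu vK]; exists v.
  have /amalgam_edgeP[l [y [x [_ _ _ eu]]]] := cK _ _ vK uK uv.
  have := words u; rewrite uK eu /= !inE.
  by case: (pi x == i); case: (pi x == j).
case eu: u.2 uo => [l|//] _.
have nbr v : v \in K -> v != u -> exists2 y, v = copy_in l y &
    exists2 x, u = copy_in l x & exists t, l t = None.
  move=> vK vu; have /amalgam_edgeP[l' [y [x [lt _ ev ex]]]] := cK _ _ vK uK vu.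
  have ll : l' = l.
    by move: eu; rewrite ex /=; case: ifP => // _ [].
  by subst l'; exists y => //; exists x.
have [K1|K1] := leqP #|K| 1; first by rewrite (leq_trans K1) // ltnW.
have [v vK uv] : exists2 v, v \in K & v != u.
  move: K1; rewrite (cardsD1 u) uK add1n ltnS card_gt0 => /set0Pn[v].
  by rewrite !inE => /andP[vu vK]; exists v.
have [_ _ [x0 ux0 lt]] := nbr v vK uv.
have -> : K = copy_in l @: (copy_in l @^-1: K).
  apply/setP => w; apply/idP/imsetP => [wK|[x + ->]]; last by rewrite inE.
  have [e|wu] := eqVneq w u; first by exists x0; rewrite ?e // inE -ux0.
  by have [y ey _] := nbr w wK wu; exists y; rewrite // inE -ey.
rewrite card_imset; last exact: copy_in_inj.
apply: Pk; apply/is_cliqueP => x y; rewrite !inE => xK yK xy.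
apply: (copy_in_edge lt); apply: cK => //.
by rewrite (inj_eq (copy_in_inj lt)).
Qed.

End Amalgam.

Section Partite.
Variables (a k : nat) (P0 : sgraph) (pi0 : P0 -> 'I_a).
Hypothesis pi0P : forall x y : P0, edge x y -> pi0 x != pi0 y.
Hypothesis P0k : clique_number P0 <= k.
Hypothesis k1 : 1 < k.

(** Induction on [L]. Amalgamating along [(i, j)] gives, by Hales-Jewett, a copy of the previous [P]
    whose edges from part [i] to part [j] have one colour. The copy of [P0] given by the induction
    hypothesis is taken inside it, so that colour persists. *)
Lemma partite_construction (L : seq ('I_a * 'I_a)) :
  exists (P : sgraph) (pi : P -> 'I_a),
   [/\ forall x y : P, edge x y -> pi x != pi y, clique_number P <= k &
    forall c : rel P, exists f : P0 -> P,
    [/\ forall x, pi (f x) = pi0 x, forall x y, edge x y -> edge (f x) (f y) &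
     forall i j, (i, j) \in L -> exists b, forall x y : P0,
       edge x y -> pi0 x = i -> pi0 y = j -> c (f x) (f y) = b]].
Proof.
elim: L => [|[i j] L [P [pi [piP Pk HP]]]].
  by exists P0, pi0; split=> // c; exists id; split.
have [eij|ij] := eqVneq i j.
  exists P, pi; split=> // c; have [f [fpi fe fL]] := HP c; exists f; split=> // i' j'.
  rewrite inE => /orP[/eqP[-> ->]|/fL//].
  exists true => x y /pi0P + ex ey; by rewrite ex ey eij eqxx.
have [I HI] := @hales_jewett (letter pi i j) bool.
exists (amalgam piP i j I), (fun u => u.1.1); split.
- exact: amalgam_proj.
- exact: amalgam_clique.
move=> c.
pose word (s : P * P -> P) (w : {ffun I -> letter pi i j}) : {ffun I -> P} :=
  [ffun t => s (val (w t))].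
pose col (w : {ffun I -> letter pi i j}) : bool :=
  c (i, word (fun e => e.1) w, None) (j, word (fun e => e.2) w, None).
have [l lt lcol] := HI col.
have [f [fpi fe fL]] := HP (fun x y => c (copy_in l x) (copy_in l y)).
exists (fun x => copy_in l (f x)); split.
- by move=> x; rewrite /= fpi.
- move=> x y xy; apply/amalgam_edgeP; exists l, (f x), (f y); split=> //; exact: fe.
move=> i' j'; rewrite inE => /orP[/eqP[-> ->]|/fL//].
suff H x y : edge x y -> pi0 x = i -> pi0 y = j ->
    exists e, c (copy_in l (f x)) (copy_in l (f y)) = col (line_point l e).
  have [/existsP[e _]|noE] := boolP [exists e : letter pi i j, true]; last first.
    exists true => x y xy px py; have [e _] := H x y xy px py.
    by case/existsP: noE; exists e.
  exists (col (line_point l e)) => x y xy px py.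
  by have [e' ->] := H x y xy px py.
move=> xy px py.
have eP : [&& edge (f x, f y).1 (f x, f y).2, pi (f x, f y).1 == i & pi (f x, f y).2 == j].
  by rewrite /= fe // !fpi px py !eqxx.
exists (exist _ (f x, f y) eP : letter pi i j).
rewrite /col /copy_in !fpi px py !eqxx orbT /= [j == i]eq_sym (negbTE ij).
by congr (c (_, _, _) (_, _, _)); apply/ffunP => t; rewrite !ffunE; case: (l t).
Qed.

End Partite.

(** * Folkman's theorem for cliques *)

Section DisjointCliques.
Variables a k : nat.

Definition cliques_vertex : finType := ({ffun 'I_k -> 'I_a} * 'I_k)%type.

(** One block for each map [g] from ['I_k] to ['I_a], the vertex [(g, s)] being meant for part
    [g s]. An injective [g] gives a [k]-clique; the inequality keeps the parts independent for the
    other maps. *)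
Definition cliques_edge : rel cliques_vertex :=
  fun u v => (u.1 == v.1) && (u.1 u.2 != v.1 v.2).

Lemma cliques_sym : symmetric cliques_edge.
Proof. by move=> u v; rewrite /cliques_edge eq_sym [u.1 _ == _]eq_sym. Qed.

Lemma cliques_irrefl : irreflexive cliques_edge.
Proof. by move=> u; rewrite /cliques_edge !eqxx. Qed.

Definition disjoint_cliques : sgraph := SGraph cliques_sym cliques_irrefl.

Lemma clique_number_disjoint_cliques : clique_number disjoint_cliques <= k.
Proof.
apply/clique_numberP => K /is_cliqueP cK.
rewrite -[k in _ <= k]card_ord -(card_in_imset (f := fun u : disjoint_cliques => u.2)).
  exact: max_card.
move=> u v uK vK e; apply: contraTeq isT => uv.
by have /andP[/eqP e1] := cK _ _ uK vK uv; rewrite e1 e eqxx.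
Qed.

End DisjointCliques.

Lemma card_geq_inj (T : finType) (S : {set T}) k : k <= #|S| ->
  exists2 g : 'I_k -> T, injective g & forall i, g i \in S.
Proof.
move=> kS; exists (fun i => enum_val (widen_ord kS i)) => [i j|i].
  by move/enum_val_inj/(congr1 val) => /= /val_inj.
exact: enum_valP.
Qed.

(** The starting graph has a [k]-clique across any [k] of the [a] parts. Once the colour of an edge
    depends only on its two parts, Ramsey's theorem applied to the parts selects a monochromatic
    clique. *)
Theorem folkman_clique k : 1 < k -> exists H : sgraph, clique_number H <= k /\
  forall c : rel H, symmetric c -> exists b, exists f : 'I_k -> H,
    forall s t, s != t -> edge (f s) (f t) /\ c (f s) (f t) = b.
Proof.
move=> k1; have [a Ha] := ramsey_sets k k.
pose P0 := disjoint_cliques a k; pose pi0 (u : P0) := u.1 u.2.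
have pi0P (x y : P0) : edge x y -> pi0 x != pi0 y by case/andP.
have [P [pi [_ Pk HP]]] :=
  partite_construction pi0P (clique_number_disjoint_cliques a k) k1 (enum {: 'I_a * 'I_a}).
exists P; split=> // c csym; have [f [_ fe fL]] := HP c.
(* Vacuously true on parts without an edge between them; the actual colour is recovered below from
   an edge of the selected clique. *)
pose c' : rel 'I_a := fun i j => `[< forall x y : P0,
  edge x y -> pi0 x = i -> pi0 y = j -> c (f x) (f y) = true >].
have c'sym : symmetric c'.
  move=> i j; apply/asboolP/asboolP => H x y;
    by rewrite csym edge_sym => xy px py; apply: H.
have mono b (S : {set 'I_a}) : k <= #|S| ->
    {in S &, forall i j, i != j -> c' i j = b} ->
    exists f' : 'I_k -> P, forall s t, s != t -> edge (f' s) (f' t) /\ c (f' s) (f' t) = b.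
  move=> /card_geq_inj[g gi gS] cS.
  pose copy s : P0 := ([ffun s => g s], s).
  have piE s : pi0 (copy s) = g s by rewrite /pi0 ffunE.
  exists (fun s => f (copy s)) => s t st.
  have e : edge (copy s) (copy t).
    by rewrite /edge /= /cliques_edge /= eqxx !ffunE (inj_eq gi).
  split; first exact: fe.
  have [|b' Hb] := fL (g s) (g t); first by rewrite mem_enum.
  have : c' (g s) (g t) = b by apply: cS => //; rewrite inj_eq.
  rewrite (Hb _ _ e) //; case: b {cS} => [/asboolP H|/negbT/asboolPn H].
    by rewrite -(Hb _ _ e) // H.
  by case: b' Hb => // Hb; case: H.
have [|[S [kS [_ cS]]]|[S [kS [_ cS]]]] := Ha _ c' [set: 'I_a] c'sym.
- by rewrite cardsT card_ord.
- by exists true; apply: mono kS cS.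
- by exists false; apply: (mono _ _ kS) => i j iS jS ij; apply/negbTE/cS.
Qed.

(** * Lower-regular pairs *)

Section LowerRegular.
Variables (U : finType).
Implicit Types (r : rel U) (A B X Y : {set U}).

Definition edges_between r X Y := \sum_(x in X) #|[set y in Y | r x y]|.

(** One-sided epsilon-regularity with epsilon [1/q]: only the lower bound [1/4] on the density is
    asked for, in division-free form. *)
Definition lower_regular q r A B :=
  forall X Y, X \subset A -> Y \subset B ->
  #|A| <= q * #|X| -> #|B| <= q * #|Y| -> #|X| * #|Y| <= 4 * edges_between r X Y.

Lemma edges_betweenE r X Y :
  edges_between r X Y = \sum_(x in X) \sum_(y in Y) r x y.
Proof.
apply: eq_bigr => x _; rewrite -sum1_card big_mkcond [RHS]big_mkcond /=.
by apply: eq_bigr => y _; rewrite inE; case: (y \in Y); case: (r x y).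
Qed.

Lemma edges_betweenC r X Y : symmetric r -> edges_between r X Y = edges_between r Y X.
Proof.
move=> rs; rewrite !edges_betweenE exchange_big.
by apply: eq_bigr => x _; apply: eq_bigr => y _; rewrite rs.
Qed.

Lemma edges_between_le r X Y : edges_between r X Y <= #|X| * #|Y|.
Proof.
rewrite -sum_nat_const; apply: leq_sum => x _; apply: subset_leq_card.
by apply/subsetP => y; rewrite inE => /andP[].
Qed.

Lemma edges_between_compl r X Y :
  edges_between r X Y + edges_between (fun x y => ~~ r x y) X Y = #|X| * #|Y|.
Proof.
rewrite -big_split -sum_nat_const; apply: eq_bigr => x _.
rewrite -(cardsID [set y | r x y] Y); congr (_ + _);
  by apply: eq_card => y; rewrite !inE // andbC.
Qed.

Lemma edges_betweenDl r X A B : X \subset A ->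
  edges_between r A B = edges_between r X B + edges_between r (A :\: X) B.
Proof.
move=> XA; rewrite /edges_between (big_setID X) /=; congr (_ + _).
by apply: eq_bigl => x; rewrite (setIidPr XA).
Qed.

Lemma edges_betweenDr r Y A B : Y \subset B ->
  edges_between r A B = edges_between r A Y + edges_between r A (B :\: Y).
Proof.
move=> YB; rewrite !edges_betweenE -big_split; apply: eq_bigr => x _.
rewrite (big_setID Y) /=; congr (_ + _).
by apply: eq_bigl => y; rewrite (setIidPr YB).
Qed.

Lemma lower_regularC q r A B : symmetric r ->
  lower_regular q r A B -> lower_regular q r B A.
Proof.
by move=> rs H X Y XB YA hX hY; rewrite mulnC edges_betweenC //; apply: H.
Qed.

Lemma lower_regular_sub q K r A B A' B' : A' \subset A -> B' \subset B ->
  #|A| <= K * #|A'| -> #|B| <= K * #|B'| ->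
  lower_regular (q * K) r A B -> lower_regular q r A' B'.
Proof.
move=> sA sB hA hB H X Y XA YB hX hY.
apply: H; [exact: subset_trans sA|exact: subset_trans sB| |].
- by apply: leq_trans hA _; rewrite (mulnC q) -mulnA leq_mul2l hX orbT.
- by apply: leq_trans hB _; rewrite (mulnC q) -mulnA leq_mul2l hY orbT.
Qed.

Local Open Scope ring_scope.

Definition denser (d : rat) r X Y :=
  d * #|X|%:R * #|Y|%:R <= (edges_between r X Y)%:R.

Lemma denser_le1 d r A B :
  denser d r A B -> A != set0 -> B != set0 -> d <= 1.
Proof.
move=> + A0 B0; have := edges_between_le r A B; rewrite -(ler_nat rat) natrM.
move=> le1 /le_trans/(_ le1); rewrite -mulrA ger_pMl // mulr_gt0 // ltr0n.
  by rewrite card_gt0.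
by rewrite card_gt0.
Qed.

(** Let [X] and [Y] witness irregularity, and cut [A * B] into [X * Y], [X * (B :\: Y)] and
    [(A :\: X) * B]. On [X * Y] the density is below [1/4], against [d >= 1/2] on average; if no
    large pair were denser, the other two rectangles could not make up for it. *)
Lemma density_increment q M r A B d : (0 < q)%N -> (12 * q * q <= M)%N ->
  1 / 2%:R <= d -> A != set0 -> B != set0 -> denser d r A B ->
  ~ lower_regular q r A B ->
  exists A' B' : {set U}, [/\ A' \subset A, B' \subset B,
    (#|A| <= M * #|A'|)%N, (#|B| <= M * #|B'|)%N &
    denser ((1 + M%:R^-1) * d) r A' B'].
Proof.
move=> q0 qM d2 A0 B0 dAB nreg.
have d1 : d <= 1 := denser_le1 dAB A0 B0.
have q_le_M : (q <= M)%N by apply: leq_trans qM; nia.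
have M0 : (0 < M)%N by exact: leq_trans q_le_M.
apply: contrapT => none; apply: nreg => X Y XA YB hX hY.
rewrite leqNgt; apply/negP => lt.
set eta : rat := M%:R^-1 in none.
have eta0 : 0 < eta by rewrite invr_gt0 ltr0n.
have etaM : eta * M%:R = 1 by rewrite mulVf // pnatr_eq0 -lt0n.
have [a0 b0] : (0 < #|A|)%N /\ (0 < #|B|)%N by rewrite !card_gt0.
set a : rat := #|A|%:R; set b : rat := #|B|%:R.
pose x : rat := #|X|%:R; pose y : rat := #|Y|%:R.
have a0' : 0 < a by rewrite ltr0n.
have b0' : 0 < b by rewrite ltr0n.
(* a rectangle of [A * B] is either thin or not much denser than [A * B] *)
have rect X' Y' : X' \subset A -> Y' \subset B ->
    (edges_between r X' Y')%:R <=
    (1 + eta) * d * #|X'|%:R * #|Y'|%:R + eta * a * b.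
  move=> XA' YB'.
  have x'a : (#|X'|%:R : rat) <= a by rewrite ler_nat subset_leq_card.
  have y'b : (#|Y'|%:R : rat) <= b by rewrite ler_nat subset_leq_card.
  have e' : ((edges_between r X' Y')%:R : rat) <= #|X'|%:R * #|Y'|%:R.
    by rewrite -natrM ler_nat edges_between_le.
  have x0' : (0 : rat) <= #|X'|%:R by [].
  have y0' : (0 : rat) <= #|Y'|%:R by [].
  have t0 : 0 <= (1 + eta) * d * #|X'|%:R * #|Y'|%:R.
    by rewrite !mulr_ge0 //; lra.
  have [hX'|hX'] := leqP #|A| (M * #|X'|); last first.
    have : #|X'|%:R <= eta * a.
      by rewrite mulrC ler_pdivlMr ?ltr0n // mulrC -natrM ler_nat ltnW.
    by nra.
  have [hY'|hY'] := leqP #|B| (M * #|Y'|); last first.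
    have : #|Y'|%:R <= eta * b.
      by rewrite mulrC ler_pdivlMr ?ltr0n // mulrC -natrM ler_nat ltnW.
    by nra.
  have : ~~ denser ((1 + eta) * d) r X' Y'.
    by apply/negP => de; apply: none; exists X', Y'.
  rewrite /denser -ltNge => /ltW.
  have : 0 <= eta * a * b by rewrite !mulr_ge0 // ltW.
  by lra.
have := dAB; rewrite /denser (edges_betweenDl _ _ XA) (edges_betweenDr _ X YB).
rewrite !natrD.
have := rect _ _ XA (subsetDl B Y); have := rect _ _ (subsetDl A X) (subxx B).
have -> : (#|A :\: X|%:R : rat) = a - x.
  by rewrite cardsD (setIidPr XA) natrB // subset_leq_card.
have -> : (#|B :\: Y|%:R : rat) = b - y.
  by rewrite cardsD (setIidPr YB) natrB // subset_leq_card.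
rewrite -/a -/b -/x => h1 h2 h3.
have h4 : 4 * (edges_between r X Y)%:R < x * y :> rat.
  by rewrite -!natrM ltr_nat.
(* The deficit on [X * Y] is at least [x * y / 4], and the excess elsewhere at most
   [3 * eta * a * b]; hence the 12. *)
have h5 : 12 * (a * b) <= M%:R * (x * y).
  rewrite -!natrM ler_nat; apply: leq_trans (leq_mul qM (leqnn _)).
  have := leq_mul hX hY; set u := (#|A| * _)%N; set v := (#|X| * _)%N.
  move=> uv; rewrite -[(12 * q * q)%N]mulnA -mulnA leq_mul2l /=.
  by rewrite (leq_trans uv) // mulnACA.
have h6 : 12 * eta * (a * b) <= x * y.
  have : eta * (12 * (a * b)) <= eta * (M%:R * (x * y)) by rewrite ler_pM2l.
  by rewrite (mulrA eta M%:R) etaM mul1r; lra.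
have P0 : 0 <= x * y by rewrite mulr_ge0.
have Q0 : 0 <= eta * (a * b) by rewrite !mulr_ge0 // ltW.
have : 0 <= (d - 1 / 2) * (x * y) by rewrite mulr_ge0 //; lra.
have : 0 <= d * eta * (x * y) by rewrite !mulr_ge0 //; lra.
have : 0 <= (1 - d) * (eta * (a * b)) by rewrite mulr_ge0 //; lra.
by nra.
Qed.

(** Each increment multiplies the density bound by [1 + 1/M] and costs a factor [M] in the sizes. As
    densities are at most 1, a regular pair appears before [s] increments are made. *)
Lemma dense_lower_regular q M : (0 < q)%N -> (12 * q * q <= M)%N ->
  forall s r A B d, 1 / 2%:R <= d -> 1 < (1 + M%:R^-1) ^+ s * d ->
  denser d r A B ->
  exists A' B' : {set U}, [/\ A' \subset A, B' \subset B,
    (#|A| <= M ^ s * #|A'|)%N, (#|B| <= M ^ s * #|B'|)%N &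
    lower_regular q r A' B'].
Proof.
move=> q0 qM s r A B; have M0 : (0 < M)%N by nia.
have Ms n t : (n <= M ^ t * n)%N by rewrite leq_pmull // expn_gt0 M0.
have [A0|] := eqVneq A set0.
  move=> d _ _ _; exists A, B; split=> // X Y.
  by rewrite A0 subset0 => /eqP->; rewrite cards0.
have [B0|] := eqVneq B set0.
  move=> _ d _ _ _; exists A, B; split=> // X Y _.
  by rewrite B0 subset0 => /eqP->; rewrite cards0 !muln0.
elim: s A B => [|s IH] A B B0 A0 d d2 ds dAB.
  by move: ds; rewrite expr0 mul1r ltNge (denser_le1 dAB).
have [reg|nreg] := pselect (lower_regular q r A B).
  by exists A, B; split; rewrite ?Ms.
have [A1 [B1 [A1A B1B hA hB de]]] := density_increment q0 qM d2 A0 B0 dAB nreg.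
have [||||A2 [B2 [A2A B2B hA2 hB2 reg]]] := IH A1 B1 _ _ _ _ _ de.
- rewrite -card_gt0 lt0n; apply: contraNneq B0 => B10.
  by rewrite -cards_eq0 -leqn0 (leq_trans hB) // B10 muln0.
- rewrite -card_gt0 lt0n; apply: contraNneq A0 => A10.
  by rewrite -cards_eq0 -leqn0 (leq_trans hA) // A10 muln0.
- have : 0 <= M%:R^-1 * d by rewrite mulr_ge0 ?invr_ge0 //; lra.
  by lra.
- by rewrite mulrA -exprSr.
exists A2, B2; split=> //; [exact: subset_trans A1A|exact: subset_trans B1B| |].
- by apply: leq_trans hA _; rewrite expnS -mulnA leq_mul.
- by apply: leq_trans hB _; rewrite expnS -mulnA leq_mul.
Qed.

End LowerRegular.

(** * Simultaneous regularity in many pairs of classes *)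

Section Systems.
Local Open Scope ring_scope.

Lemma lower_regular_color q : (0 < q)%N -> exists2 K, (0 < K)%N &
  forall (U : finType) (r : rel U) (A B : {set U}), exists A' B' : {set U},
    [/\ A' \subset A, B' \subset B, (#|A| <= K * #|A'|)%N, (#|B| <= K * #|B'|)%N &
    lower_regular q r A' B' \/ lower_regular q (fun x y => ~~ r x y) A' B'].
Proof.
move=> q0; pose M := (12 * q * q)%N.
have M0 : (0 < M)%N by rewrite !muln_gt0 q0.
exists (M ^ (2 * M))%N => [|U r A B]; first by rewrite expn_gt0 M0.
(* By Bernoulli's inequality [2 * M] increments multiply the density by at least 3, which takes the
   initial [1/2] of the majority colour above 1. *)
have big : 1 < (1 + M%:R^-1) ^+ (2 * M) * (1 / 2%:R) :> rat.
  have bern n : 1 + n%:R * M%:R^-1 <= (1 + M%:R^-1) ^+ n :> rat.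
    have i0 : 0 < M%:R^-1 :> rat by rewrite invr_gt0 ltr0n.
    elim: n => [|n IHn]; first by rewrite mul0r addr0 expr0.
    rewrite exprS; apply: le_trans (_ : (1 + M%:R^-1) * (1 + n%:R * M%:R^-1) <= _).
      have : 0 <= M%:R^-1 * (n%:R * M%:R^-1) :> rat by rewrite !mulr_ge0 ?invr_ge0.
      by rewrite -natr1; lra.
    by rewrite ler_pM2l // ltr_wpDl.
  have := bern (2 * M)%N; rewrite natrM -mulrA mulfV ?pnatr_eq0 -?lt0n //.
  by lra.
have half : denser (1 / 2%:R) r A B \/ denser (1 / 2%:R) (fun x y => ~~ r x y) A B.
  have := edges_between_compl r A B => /(congr1 (fun n => n%:R : rat)).
  rewrite natrD natrM /denser => e.
  have [] := leP ((edges_between (fun x y => ~~ r x y) A B)%:R : rat)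
    (edges_between r A B)%:R.
    by move=> h; left; lra.
  by move=> h; right; lra.
case: half => h.
  have [A' [B' [? ? ? ? ?]]] := dense_lower_regular q0 (leqnn M) (lexx _) big h.
  by exists A', B'; split=> //; left.
have [A' [B' [? ? ? ? ?]]] := dense_lower_regular q0 (leqnn M) (lexx _) big h.
by exists A', B'; split=> //; right.
Qed.

End Systems.

Lemma eq_lower_regular (U : finType) q (r r' : rel U) (A B : {set U}) :
  {in A & B, r =2 r'} -> lower_regular q r A B -> lower_regular q r' A B.
Proof.
move=> rr' H X Y XA YB hX hY; rewrite (leq_trans (H X Y XA YB hX hY)) //.
rewrite !edges_betweenE leq_mul2l /=; apply: leq_sum => x xX.
by apply: leq_sum => y yY; rewrite rr' ?(subsetP XA) ?(subsetP YB).
Qed.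

(** [K] is fixed before [U] and depends only on [L] and [q]: this is what makes the final bound
    linear. *)
Lemma lower_regular_system (V : finType) (L : seq (V * V)) (q : nat) : 0 < q ->
  exists2 K, 0 < K & forall (U : finType) (r : rel U) (W : V -> {set U}),
  exists W' : V -> {set U}, (forall v, W' v \subset W v /\ #|W v| <= K * #|W' v|) /\
    forall u v, (u, v) \in L -> u != v ->
      lower_regular q r (W' u) (W' v) \/
      lower_regular q (fun x y => ~~ r x y) (W' u) (W' v).
Proof.
move=> q0; elim: L => [|[u v] L [K K0 IH]].
  by exists 1 => // U r W; exists W; split=> // v; rewrite mul1n.
have [U1|] := eqVneq u v.
  exists K => // U r W; have [W' [sW' H]] := IH U r W; exists W'; split=> // x y.
  by rewrite inE => /orP[/eqP[-> ->]|/H//]; rewrite U1 eqxx.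
move=> uv.
(* The remaining pairs may shrink these sets by a factor [K], so regularity is requested with
   [q * K] to retain [q]. *)
have [|K1 K10 H1] := @lower_regular_color (q * K); first by rewrite muln_gt0 q0.
exists (K1 * K); first by rewrite muln_gt0 K10.
move=> U r W; have [A [B [AW BW hA hB reg]]] := H1 U r (W u) (W v).
pose W1 x := if x == u then A else if x == v then B else W x.
have W1u : W1 u = A by rewrite /W1 eqxx.
have W1v : W1 v = B by rewrite /W1 eqxx eq_sym (negbTE uv).
have [W' [sW' H]] := IH U r W1.
have sW1 x : W1 x \subset W x /\ #|W x| <= K1 * #|W1 x|.
  rewrite /W1; have [->//|_] := eqVneq x u; have [->//|_] := eqVneq x v.
  by rewrite leq_pmull.
exists W'; split=> [x|x y].
  have [s1 h1] := sW1 x; have [s2 h2] := sW' x.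
  by rewrite (subset_trans s2 s1) (leq_trans h1) // -mulnA leq_mul.
rewrite inE => /orP[/eqP[-> ->] _|/H//].
have [+ +] := sW' u; have [+ +] := sW' v; rewrite W1u W1v => sv hv su hu.
by case: reg => reg; [left|right]; apply: (lower_regular_sub (K := K)) reg.
Qed.

(** * Embedding of bounded degree graphs *)

Lemma degree_le (G : sgraph) (x : G) : #|[set y : G | edge x y]| <= max_degree G.
Proof. exact: (leq_bigmax x). Qed.

Lemma greedy_coloring (G : sgraph) (d : nat) : max_degree G <= d ->
  exists chi : G -> 'I_d.+1, forall x y : G, edge x y -> chi x != chi y.
Proof.
move=> deg.
suff H (s : seq G) : exists chi : G -> 'I_d.+1,
    {in s &, forall x y, edge x y -> chi x != chi y}.
  by have [chi H'] := H (enum G); exists chi => x y; apply: H'; rewrite mem_enum.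
elim: s => [|v s [chi IH]]; first by exists (fun=> ord0).
pose used := [set chi y | y in [set y : G | edge v y]].
have [i iN] : exists i, i \notin used.
  apply/existsP; rewrite -negb_forall; apply/negP => /forallP all.
  have : #|used| <= d.
    by apply: leq_trans (leq_imset_card _ _) _; apply: leq_trans (degree_le v) deg.
  suff -> : #|used| = d.+1 by rewrite ltnn.
  by rewrite -[RHS]card_ord; apply: eq_card => i; rewrite all.
have free y : edge v y -> chi y != i.
  by move=> vy; apply: contraNneq iN => <-; apply: imset_f; rewrite inE.
exists (fun x => if x == v then i else chi x) => x y.
rewrite !inE; have [->|xv] /= := eqVneq x v; have [->|yv] /= := eqVneq y v.
- by rewrite edge_irrefl.
- by rewrite eq_sym => _ _ /free.
- by rewrite edge_sym => _ _ /free.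
- exact: IH.
Qed.

(** Were the set of bad vertices large, it would form with [Y] a pair of density below [1/4],
    against regularity. *)
Lemma lower_regular_few_bad (U : finType) (q : nat) (r : rel U) (A B Y : {set U}) :
  0 < #|A| -> lower_regular q r A B -> Y \subset B -> #|B| <= q * #|Y| ->
  q * #|[set w in A | 4 * #|[set y in Y | r w y]| < #|Y|]| < #|A|.
Proof.
move=> A0 reg YB hY; set X := [set w in A | _].
have [X0|/set0Pn[w0 w0X]] := eqVneq X set0; first by rewrite X0 cards0 muln0.
rewrite ltnNge; apply/negP => hX.
have XA : X \subset A by apply/subsetP => w; rewrite inE => /andP[].
have := reg X Y XA YB hX hY; rewrite leqNgt => /negP; apply.
rewrite /edges_between big_distrr -sum_nat_const /=.
rewrite (big_setD1 w0) //= [ltnRHS](big_setD1 w0) //= -addSn leq_add //.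
  by move: w0X; rewrite inE => /andP[].
by apply: leq_sum => w; rewrite !inE => /andP[_ /andP[_ /ltnW]].
Qed.

Section Embedding.
Variables (G : sgraph) (d k : nat) (chi : G -> 'I_k).
Hypothesis deg : max_degree G <= d.
Hypothesis chiP : forall x y : G, edge x y -> chi x != chi y.
Variables (U : finType) (r : rel U) (W : 'I_k -> {set U}).
Hypothesis r_sym : symmetric r.
(** The factor [4 ^ d] makes every candidate set large enough for regularity; [2 * d.+1] leaves room
    for at most [d] bad sets and the images in use. *)
Let q := 2 * d.+1 * 4 ^ d.
Hypothesis reg : forall i j, i != j -> lower_regular q r (W i) (W j).
Hypothesis W_large : forall i, 2 * 4 ^ d * #|G| <= #|W i|.

Let done_nbrs (S : {set G}) v := [set u in S | edge v u].
(** Images already in use are not removed here; injectivity comes from avoiding [spoiled] below. *)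
Let cand (S : {set G}) (f : G -> U) v :=
  [set w in W (chi v) | [forall u in done_nbrs S v, r (f u) w]].

Lemma greedy_embedding : exists2 f : G -> U, injective f &
  forall x y : G, edge x y -> r (f x) (f y).
Proof.
(* The induction starts from a default image [u0]; if [U] is empty, [W_large] forces [G] to be empty
   too. *)
have [u0|noU] := pickP U; last first.
  have noG (v : G) : False.
    have : 0 < #|W (chi v)|.
      apply: leq_trans (W_large _); rewrite !muln_gt0 expn_gt0 /=.
      by apply/card_gt0P; exists v.
    by case/card_gt0P => u; have := noU u.
  by exists (fun v => False_rect U (noG v)) => x; case: (noG x).
(* Invariant: every embedded neighbour costs a candidate set at most a factor 4. *)
suff H s : s <= #|G| -> exists (S : {set G}) (f : G -> U), [/\ #|S| = s,
    {in S &, injective f}, {in S &, forall x y, edge x y -> r (f x) (f y)} &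
    forall v, v \notin S ->
      #|W (chi v)| <= 4 ^ #|done_nbrs S v| * #|cand S f v|].
  have [S [f [cS fi fe _]]] := H #|G| (leqnn _).
  have ST : S = setT by apply/eqP; rewrite eqEcard subsetT cardsT cS leqnn.
  exists f => [x y|x y]; first by apply: fi; rewrite ST inE.
  by apply: fe; rewrite ST inE.
elim: s => [_|s IH ltsG].
  exists set0, (fun=> u0); split; rewrite ?cards0 //; try by move=> x y; rewrite inE.
  move=> v _; have -> : done_nbrs set0 v = set0 by apply/setP => u; rewrite !inE.
  rewrite cards0 mul1n subset_leq_card //; apply/subsetP => w wW.
  by rewrite inE wW; apply/forall_inP => u; rewrite !inE.
have [S [f [cS fi fe fc]]] := IH (ltnW ltsG).
have [v vS] : exists v, v \notin S.
  apply/existsP; rewrite -negb_forall; apply/negP => /forallP all.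
  move: ltsG; rewrite -cS ltnNge => /negP; apply; apply: subset_leq_card.
  by apply/subsetP => x _; have := all x; case: (x \in S).
have dn_le x : #|done_nbrs S x| <= d.
  apply: leq_trans (leq_trans (degree_le x) deg); apply: subset_leq_card.
  by apply/subsetP => y; rewrite !inE => /andP[].
have cand_large x : x \notin S -> #|W (chi x)| <= 4 ^ d * #|cand S f x|.
  move/fc => h; apply: leq_trans h _; rewrite leq_mul2r leq_exp2l //.
  by rewrite dn_le orbT.
have cand_sub x : cand S f x \subset W (chi x).
  by apply/subsetP => w; rewrite inE => /andP[].
have W0 x : 0 < #|W (chi x)|.
  by apply: leq_trans (W_large _); rewrite !muln_gt0 expn_gt0 /= (leq_trans _ ltsG).
pose todo := [set u | edge v u] :\: S.
pose bad u := [set w in W (chi v) |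
  4 * #|[set y in cand S f u | r w y]| < #|cand S f u|].
have bad_small u : u \in todo -> q * #|bad u| < #|W (chi v)|.
  rewrite !inE => /andP[uS vu].
  apply: (lower_regular_few_bad (B := W (chi u))) => //.
  - exact/reg/chiP.
  - apply: leq_trans (cand_large _ uS) _; rewrite leq_mul2r /q leq_pmull ?orbT //.
pose spoiled := (f @: S) :|: \bigcup_(u in todo) bad u.
have spoiled_lt : #|spoiled| < #|cand S f v|.
  have todo_d : #|todo| <= d.
    by apply: leq_trans (leq_trans (degree_le v) deg); apply/subset_leq_card/subsetDl.
  have h1 : #|spoiled| <= s + \sum_(u in todo) #|bad u|.
    rewrite -cS; apply: leq_trans (leq_card_setU _ _) _.
    rewrite leq_add ?leq_imset_card //.
    elim/big_rec2: _ => [|u m B _ le]; first by rewrite cards0.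
    by apply: leq_trans (leq_card_setU _ _) _; rewrite leq_add2l.
  have h2 : q * \sum_(u in todo) #|bad u| <= d * #|W (chi v)|.
    rewrite big_distrr /= (@leq_trans (\sum_(u in todo) #|W (chi v)|)) //.
      by apply: leq_sum => u /bad_small /ltnW.
    by rewrite sum_nat_const leq_mul2r todo_d orbT.
  have h3 := cand_large _ vS; have h4 := W_large (chi v); have h5 := W0 v.
  have q0 : 0 < q by rewrite !muln_gt0 expn_gt0.
  rewrite -(ltn_pmul2l q0) (leq_ltn_trans (n := q * (s + \sum_(u in todo) #|bad u|))) //.
    by rewrite leq_mul2l h1 orbT.
  rewrite mulnDr.
  have h6 : q * s <= d.+1 * #|W (chi v)|.
    rewrite (@leq_trans (d.+1 * (2 * 4 ^ d * #|G|))) //; last by rewrite leq_mul2l h4.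
    by rewrite /q (mulnC 2) -!mulnA !leq_mul // ltnW.
  have h7 : 2 * d.+1 * #|W (chi v)| <= q * #|cand S f v|.
    by rewrite /q -[X in _ <= X]mulnA leq_mul2l h3 orbT.
  (* After multiplication by [q], in units of the class size, used images weigh at most [d + 1] and
     bad sets at most [d], against at least [2 * d + 2] for the candidates. *)
  by apply: leq_trans h7; lia.
have [w wc wN] : exists2 w, w \in cand S f v & w \notin spoiled.
  apply/exists_inP; rewrite -[X in is_true X]negbK negb_exists_in.
  apply/negP => /forall_inP all.
  move: spoiled_lt; rewrite ltnNge subset_leq_card //.
  by apply/subsetP => w /all; rewrite negbK.
pose f' x := if x == v then w else f x.
have f'S x : x \in S -> f' x = f x.
  by rewrite /f'; case: eqP => // ->; rewrite (negbTE vS).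
have f'v : f' v = w by rewrite /f' eqxx.
have wfS x : x \in S -> f x != w.
  move=> xS; apply: contraNneq wN => <-.
  by rewrite inE imset_f.
have rfw x : x \in S -> edge v x -> r (f x) w.
  move=> xS vx; move: wc; rewrite inE => /andP[_ /forall_inP]; apply.
  by rewrite inE xS.
exists (v |: S), f'; split.
- by rewrite cardsU1 vS cS.
- move=> x y; rewrite !inE => /orP[/eqP->|xS] /orP[/eqP->|yS] //; rewrite ?f'v ?f'S //.
  + by move/esym/eqP; rewrite (negbTE (wfS _ yS)).
  + by move/eqP; rewrite (negbTE (wfS _ xS)).
  + exact: fi.
- move=> x y; rewrite !inE => /orP[/eqP->|xS] /orP[/eqP->|yS] //; rewrite ?f'v ?f'S //.
  + by rewrite edge_irrefl.
  + by rewrite r_sym; apply: rfw.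
  + by rewrite edge_sym; apply: rfw.
  + exact: fe.
move=> u; rewrite !inE negb_or => /andP[uv uS].
have [vu|nvu] := boolP (edge v u); last first.
  have -> : done_nbrs (v |: S) u = done_nbrs S u.
    apply/setP => x; rewrite !inE; case: eqVneq => //= ->.
    by rewrite edge_sym (negbTE nvu) andbF.
  suff -> : cand (v |: S) f' u = cand S f u by apply: fc.
  apply/setP => y; rewrite !inE; congr (_ && _).
  apply/forall_inP/forall_inP => H x; rewrite !inE.
    by move=> /andP[xS ux]; rewrite -(f'S _ xS); apply: H; rewrite !inE xS orbT.
  case: eqVneq => [->|_] /=; first by rewrite edge_sym (negbTE nvu).
  by move=> /andP[xS ux]; rewrite (f'S _ xS); apply: H; rewrite !inE xS.
have -> : done_nbrs (v |: S) u = v |: done_nbrs S u.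
  apply/setP => x; rewrite !inE; case: eqVneq => //= ->.
  by rewrite edge_sym.
rewrite cardsU1 inE (negbTE vS) /= add1n expnS (mulnC 4) -mulnA.
apply: leq_trans (fc _ uS) _; rewrite leq_mul2l.
(* As [w] is not bad for [u], at least a quarter of the candidates of [u] survive, which pays for
   the new factor 4. *)
have : w \notin bad u.
  apply: contra wN => wb; rewrite inE; apply/orP; right.
  by apply/bigcupP; exists u => //; rewrite !inE uS.
rewrite inE (subsetP (cand_sub _) _ wc) /= -leqNgt => h.
apply/orP; right; apply: leq_trans h _; rewrite leq_mul2l /= subset_leq_card //.
apply/subsetP => y; rewrite !inE => /andP[/andP[-> /forall_inP H] wy] /=.
apply/forall_inP => x; rewrite !inE; case: (eqVneq x v) => [->|_] /=.
  by rewrite f'v.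
by move=> /andP[xS ux]; rewrite (f'S _ xS); apply: H; rewrite !inE xS.
Qed.

End Embedding.

(** * Blow-ups *)

Section BlowUp.
Variables (H : sgraph) (m : nat).

Definition blow_up_vertex : finType := (H * 'I_m)%type.

Definition blow_up_edge : rel blow_up_vertex := fun u v => edge u.1 v.1.

Lemma blow_up_sym : symmetric blow_up_edge.
Proof. by move=> u v; apply: edge_sym. Qed.

Lemma blow_up_irrefl : irreflexive blow_up_edge.
Proof. by move=> u; apply: edge_irrefl. Qed.

Definition blow_up : sgraph := SGraph blow_up_sym blow_up_irrefl.

Lemma card_blow_up : #|blow_up| = #|H| * m.
Proof. by rewrite card_prod card_ord. Qed.

Lemma clique_number_blow_up k : clique_number H <= k -> clique_number blow_up <= k.
Proof.
move=> /clique_numberP Hk; apply/clique_numberP => K /is_cliqueP cK.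
have fstK : {in K &, injective (fun u : blow_up => u.1)}.
  move=> u v uK vK e; apply: contraTeq isT => uv.
  by have := cK _ _ uK vK uv; rewrite /edge /= /blow_up_edge e edge_irrefl.
rewrite -(card_in_imset fstK); apply: Hk; apply/is_cliqueP.
move=> _ _ /imsetP[u uK ->] /imsetP[v vK ->] uv; apply: (cK u v) => //.
by apply: contraNneq uv => ->.
Qed.

Definition fiber (x : H) : {set blow_up} := [set u | u.1 == x].

Lemma card_fiber x : #|fiber x| = m.
Proof.
rewrite -[RHS]card_ord -(card_imset (f := fun t : 'I_m => (x, t) : blow_up)).
  apply: eq_card => -[y t]; rewrite inE; apply/eqP/imsetP => /= [->|[s _ [-> _]]//].
  by exists t.
by move=> s t [].
Qed.

End BlowUp.

(** * The host graph and the linear bound *)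

Lemma linear_folkman_graph d : 0 < d ->
  exists C : nat, forall G : sgraph, max_degree G <= d ->
  exists F : sgraph, [/\ #|F| = C * #|G|, arrows F G & clique_number F <= d.+1].
Proof.
move=> d0; have [//|H [Hk HF]] := @folkman_clique d.+1.
pose q := 2 * d.+1 * 4 ^ d.
have q0 : 0 < q by rewrite !muln_gt0 expn_gt0.
have [K K0 HS] := lower_regular_system (enum {: H * H}) q0.
exists (#|H| * (K * (2 * 4 ^ d))) => G deg.
pose m := K * (2 * 4 ^ d) * #|G|.
exists (blow_up H m); split; first by rewrite card_blow_up /m !mulnA.
  move=> col; pose r : rel (blow_up H m) := fun u v => col [set u; v].
  have r_sym : symmetric r by move=> u v; rewrite /r setUC.
  have [W [sW HW]] := HS _ r (@fiber H m).
  have W_fiber x u : u \in W x -> u.1 = x.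
    by have [/subsetP sx _] := sW x; move/sx; rewrite inE => /eqP.
  have W_large x : 2 * 4 ^ d * #|G| <= #|W x|.
    rewrite -(leq_pmul2l K0) mulnA; have [_] := sW x.
    by apply: leq_trans; rewrite card_fiber.
  (* On a pair coloured [false], [HW] leaves only regularity of the complementary colour. *)
  pose c : rel H := fun x y => `[< lower_regular q r (W x) (W y) >].
  have c_sym : symmetric c.
    by move=> x y; apply/asboolP/asboolP; apply: lower_regularC.
  have [b [f fP]] := HF c c_sym.
  have [chi chiP] := greedy_coloring deg.
  pose rb : rel (blow_up H m) := fun u v => edge u v && (r u v == b).
  have rb_sym : symmetric rb by move=> u v; rewrite /rb edge_sym r_sym.
  have reg s t : s != t -> lower_regular q rb (W (f s)) (W (f t)).
    move=> st; have [fst cst] := fP s t st.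
    (* As [f s] and [f t] are adjacent, all pairs between their classes are edges of the blow-up, so
       [rb] reduces to the colour condition there. *)
    have rbE r' : (forall u v, r' u v = (r u v == b)) ->
        lower_regular q r' (W (f s)) (W (f t)) -> lower_regular q rb (W (f s)) (W (f t)).
      move=> r'E; apply: eq_lower_regular => u v uW vW; rewrite r'E /rb.
      by rewrite /edge /= /blow_up_edge (W_fiber _ _ uW) (W_fiber _ _ vW) fst.
    have [||reg|reg] := HW (f s) (f t).
    - by rewrite mem_enum.
    - by apply: contraTneq fst => ->; rewrite edge_irrefl.
    - have b_true : true = b by rewrite -cst; apply/esym/asboolT.
      by apply: (rbE r) reg => u v; rewrite -b_true eqb_id.
    - move: cst; case: b fP @rb rb_sym rbE => fP rb rb_sym rbE.
        by move/asboolP; apply: rbE => u v; rewrite eqb_id.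
      by move=> _; apply: rbE reg => u v; rewrite eqbF_neg.
  have [g gi gP] := greedy_embedding deg chiP rb_sym
    (fun i j => @reg i j) (fun i => W_large (f i)).
  exists b, g => // x y xy.
  by have /andP[? /eqP ?] := gP x y xy.
exact: clique_number_blow_up.
Qed.

(** This makes room for the clique number [Delta + 1] of the host. A copy of [K_k] in [K_k] uses
    every edge, so giving one edge a colour of its own defeats it as soon as there are other edges,
    that is for [k >= 3]. *)
Lemma ramsey_gt k : 2 < k -> k < ramsey (complete_graph k).
Proof.
move=> k2; rewrite /ramsey; case: ex_minnP => N /asboolP arr _; rewrite ltnNge.
apply/negP => Nk.
have k0 : 0 < k by apply: leq_trans k2.
have k1 : 1 < k by apply: leq_trans k2.
pose v0 := Ordinal k0; pose v1 := Ordinal k1; pose v2 := Ordinal k2.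
have [_ [f0 f0i _]] := arr (fun=> true).
have kN : k <= N by have := leq_card f0 f0i; rewrite !card_ord.
have Nk' : N = k by apply/eqP; rewrite eqn_leq Nk.
subst N; have [b [f fi fb]] := arr (fun s : {set 'I_k} => s == [set v0; v1]).
have [g fK gK] := injF_bij fi.
have gi : injective g := can_inj gK.
have [] := fb (g v0) (g v1); first by rewrite /edge /= (inj_eq gi).
have [] := fb (g v0) (g v2); first by rewrite /edge /= (inj_eq gi).
rewrite !gK eqxx => _ <- _ /esym/eqP/setP/(_ v2).
by rewrite !inE eqxx orbT.
Qed.

Theorem theorem3 (R : realType) (Delta p : nat) (hDelta : 3 <= Delta)
  (hp : p = ramsey (complete_graph Delta)) :
  folkman_linear R p (fun G : sgraph => max_degree G <= Delta).
Proof.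
have [|C HC] := @linear_folkman_graph Delta; first exact: leq_trans hDelta.
(* The successor guarantees a positive constant whatever [C] is. *)
exists C.+1%:R%R; split=> [|n G deg <-]; first by rewrite ltr0Sn.
have [F [cF arrF clF]] := HC G deg.
have ordF : folkman_order G p (C * #|G|).
  by exists F; split=> //; rewrite (leq_trans clF) // hp ramsey_gt.
rewrite /folkman; case: pselect => [exN|[]]; last by exists (C * #|G|); apply/asboolP.
case: ex_minnP => N _ minN; rewrite lee_fin -natrM ler_nat.
apply: leq_trans (minN (C * #|G|) _) _; first exact/asboolP.
by rewrite leq_mul2r leqnSn orbT.
Qed.
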